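(* Let $K$ be a complete discretely valued field with ring of integers $\mathcal{O}_K$, uniformiser $\pi$ and residue field $\mathbb{F}$, and let $\rho\colon G\to\mathrm{GL}(V)$ be an irreducible representation of a group $G$ on a finite-dimensional $K$-vector space $V$ admitting at least one $\rho(G)$-stable lattice. Write $\overline\rho^{ss}=\bigoplus_{i=1}^rW_i^{m_i}$ with the $W_i$ pairwise non-isomorphic irreducible $\mathbb{F}[G]$-modules. Suppose that $\rho$ realises a non-split extension class $\alpha=[U,f,g]\in\mathrm{Ext}_{\mathbb{F}[G]}(W_i,W_j)$ for some $1\le i,j\le r$. Then there is a maximal stable lattice $\Lambda_x$ such that $U$ is isomorphic to a subrepresentation of $\Lambda_x/\pi\Lambda_x$; in particular $\alpha$ is realised by $\Lambda_x$.
   Context: A lattice in $V$ is a free $\mathcal{O}_K$-submodule of rank $\dim_KV$, $\rho(G)$-stable if $\rho(g)\Lambda=\Lambda$ for all $g$. A stable lattice $\Lambda$ is normalised at a nonzero $v\in V$ if $v\in\Lambda$ and its image in $\Lambda/\pi\Lambda$ is nonzero; it is maximal with respect to $v$ if it is maximal under inclusion among stable lattices normalised at $v$; it is maximal if it is maximal with respect to some nonzero $v$. $[U,f,g]$ denotes the extension class of a short exact sequence $0\to W_j\xrightarrow{f}U\xrightarrow{g}W_i\to0$ of $\mathbb{F}[G]$-modules. A stable lattice $\Lambda$ realises $\alpha$ if there are subrepresentations $U_0\subseteq U_1\subseteq\Lambda/\pi\Lambda$ such that $U_1/U_0$ fits into a short exact sequence $0\to W_j\to U_1/U_0\to W_i\to0$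 defining $\alpha$; $\rho$ realises $\alpha$ if some stable lattice does. *)

(* Defs.v *)
From HB Require Import structures.
From mathcomp Require Import all_boot all_order all_algebra.
From mathcomp Require Import generic_quotient ring_quotient.
From mathcomp Require Import boolp classical_sets.

Set Implicit Arguments.
Unset Strict Implicit.
Unset Printing Implicit Defensive.

Import Order.TTheory GRing.Theory Num.Theory.
Local Open Scope ring_scope.
Local Open Scope classical_set_scope.
Local Open Scope quotient_scope.

(* [val_ge v N x] is "v(x) >= N" under the convention v(0) = +oo; the value of
   v at 0 is otherwise irrelevant. *)
Definition val_ge (K : fieldType) (v : K -> int) (N : int) : {pred K} :=
  fun x => (x == 0) || (N <= v x).

Definition val_cauchy (K : fieldType) (v : K -> int) (u : nat -> K) :=
  forall N : int, exists n0 : nat, forall p q : nat,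
    (n0 <= p)%N -> (n0 <= q)%N -> u p - u q \in val_ge v N.

Definition val_cvg (K : fieldType) (v : K -> int) (u : nat -> K) (l : K) :=
  forall N : int, exists n0 : nat, forall p : nat,
    (n0 <= p)%N -> u p - l \in val_ge v N.

(* The valuation is normalised (surjective onto int), and the structure carries
   a choice of uniformiser. *)
HB.mixin Record Field_isCompleteDiscretelyValued K of GRing.Field K := {
  dval : K -> int;
  dvalM : forall x y, x != 0 -> y != 0 -> dval (x * y) = dval x + dval y;
  dvalD : forall x y, x != 0 -> y != 0 -> x + y != 0 ->
    Order.min (dval x) (dval y) <= dval (x + y);
  unif : K;
  unif_neq0 : unif != 0;
  dval_unif : dval unif = 1;
  dval_complete : forall u, val_cauchy dval u -> exists l, val_cvg dval u l
}.

#[short(type="cdvFieldType")]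
HB.structure Definition CDVField :=
  {K of GRing.Field K & Field_isCompleteDiscretelyValued K}.

Section Integers.
Variable K : cdvFieldType.
Implicit Types x y : K.

Definition int_pred : {pred K} := val_ge dval 0.

Lemma dval1 : dval (1 : K) = 0.
Proof.
have := dvalM (1 : K) 1 (oner_neq0 _) (oner_neq0 _).
by rewrite mulr1 -{1}[dval 1]addr0 => /addrI <-.
Qed.

Lemma dvalN1 : dval (- 1 : K) = 0.
Proof.
have n0 : (- 1 : K) != 0 by rewrite oppr_eq0 oner_neq0.
have := dvalM _ _ n0 n0; rewrite mulrNN mulr1 dval1.
by move/esym/eqP; rewrite -mulr2n mulrn_eq0 => /eqP.
Qed.

Lemma val_geD N x y :
  x \in val_ge dval N -> y \in val_ge dval N -> x + y \in val_ge dval N.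
Proof.
rewrite !unfold_in.
have [-> | x0] /= := eqVneq x 0; first by rewrite add0r.
have [-> | y0] /= := eqVneq y 0; first by rewrite addr0 (negPf x0).
have [// | s0] /= := eqVneq (x + y) 0.
move=> hx hy; apply: le_trans _ (dvalD _ _ x0 y0 s0).
by rewrite le_min hx hy.
Qed.

Lemma val_geM N N' x y :
  x \in val_ge dval N -> y \in val_ge dval N' -> x * y \in val_ge dval (N + N').
Proof.
rewrite !unfold_in mulf_eq0.
have [// | x0] /= := eqVneq x 0; have [// | y0] /= := eqVneq y 0.
by move=> hx hy; rewrite dvalM // lerD.
Qed.

Fact int_subring_closed : subring_closed int_pred.
Proof.
have h1 : 1 \in int_pred by rewrite unfold_in dval1 lexx orbT.
have hM : {in int_pred &, forall x y, x * y \in int_pred}.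
  by move=> x y hx hy; rewrite /int_pred -[0]addr0; apply: val_geM.
split=> // x y hx hy; apply: val_geD => //.
rewrite -mulN1r; apply: hM => //.
by rewrite unfold_in dvalN1 lexx orbT.
Qed.

HB.instance Definition _ :=
  GRing.isSubringClosed.Build K int_pred int_subring_closed.

Record integers := Integers { int_val :> K; _ : int_val \in int_pred }.

HB.instance Definition _ := [isSub for int_val].
HB.instance Definition _ := [Choice of integers by <:].
HB.instance Definition _ := [SubChoice_isSubComNzRing of integers by <:].

Definition max_ideal : {pred integers} := fun a => int_val a \in val_ge dval 1.

Fact max_ideal_closed : idealr_closed max_ideal.
Proof.
split.
- by rewrite unfold_in /= unfold_in eqxx.
- by rewrite unfold_in /= unfold_in oner_eq0 dval1.
move=> a x y; rewrite ![_ \in max_ideal]unfold_in => hx hy.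
rewrite /= ; apply: val_geD => //; rewrite -[1]add0r; apply: val_geM => //.
by case: a.
Qed.

HB.instance Definition _ := isIdealr.Build integers max_ideal max_ideal_closed.

Definition residue : Type := {ideal_quot max_ideal}.

HB.instance Definition _ := GRing.ComNzRing.on residue.
HB.instance Definition _ := @EqQuotient.on residue.

Fact int_inv_subproof (a : integers) : a \notin max_ideal ->
  (int_val a)^-1 \in int_pred.
Proof.
case: a => a ha; rewrite !unfold_in /= negb_or => /andP[a0 /negP hv].
have hV : a^-1 != 0 by rewrite invr_eq0.
rewrite (negPf hV) /=.
have : dval a + dval a^-1 = 0 by rewrite -dvalM // divff // dval1.
move/eqP; rewrite addrC addr_eq0 => /eqP ->.
rewrite oppr_ge0 leNgt; apply/negP => h; by apply: hv; rewrite -gtz0_ge1.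
Qed.

Definition int_inv (a : integers) : integers :=
  if a \in max_ideal then 0 else insubd 0 (int_val a)^-1.

Definition residue_inv (x : residue) : residue :=
  \pi_residue (int_inv (repr x)).

Fact residue_mulVf : forall x : residue, x != 0 -> residue_inv x * x = 1.
Proof.
move=> x; rewrite -{1}[x]reprK -(rmorph0 \pi_residue) -Quotient.idealrBE subr0.
move=> hx; rewrite /residue_inv /int_inv (negPf hx) -{2}[x]reprK -rmorphM.
rewrite -(rmorph1 \pi_residue); congr (\pi_residue _).
apply: val_inj; rewrite /= -/(val (insubd _ _)) insubdK ?int_inv_subproof //.
by rewrite mulVf //; apply: contra hx => h; rewrite !unfold_in h.
Qed.

Fact residue_inv0 : residue_inv 0 = 0.
Proof.
rewrite /residue_inv /int_inv ifT ?rmorph0 //.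
by rewrite -[repr _]subr0 Quotient.idealrBE reprK rmorph0.
Qed.

HB.instance Definition _ :=
  GRing.ComNzRing_isField.Build residue residue_mulVf residue_inv0.

Fact unif_int_subproof : (unif : K) \in int_pred.
Proof. by rewrite unfold_in dval_unif orbT. Qed.

Definition unifO : integers := Integers unif_int_subproof.

End Integers.

Local Notation "''O_' K" := (integers K) (at level 8, K at level 2, format "''O_' K").
Arguments unifO {K}.

Record gaction (R : nzRingType) (G : groupType) (M : lmodType R) := GAction {
  gact :> G -> M -> M;
  gact_linear : forall g, linear (gact g);
  gact1 : forall x, gact 1%g x = x;
  gactM : forall g h x, gact (g * h)%g x = gact g (gact h x)
}.

HB.instance Definition _ (R : nzRingType) (G : groupType) (M : lmodType R)
    (rho : gaction G M) (g : G) :=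
  GRing.isLinear.Build R M M *:%R (gact rho g) (gact_linear rho g).

Record gmod (R : nzRingType) (G : groupType) := GMod {
  gmod_sort :> lmodType R;
  gmod_act : gaction G gmod_sort
}.
Arguments GMod {R G gmod_sort} gmod_act.

Section GModules.
Variables (R : nzRingType) (G : groupType).
Implicit Types M N P : gmod R G.

Record ghom M N := GHom {
  ghom_fun :> M -> N;
  ghom_linear : linear ghom_fun;
  ghom_act : forall g x, ghom_fun (gmod_act M g x) = gmod_act N g (ghom_fun x)
}.

HB.instance Definition _ M N (f : ghom M N) :=
  GRing.isLinear.Build R M N *:%R (ghom_fun f) (ghom_linear f).

Definition gisom M N := exists f : ghom M N, bijective f.

Record subrep M := SubRep {
  subrep_set :> set M;
  subrep_submod : submod_closed (mem subrep_set);
  subrep_act : forall g x, subrep_set x -> subrep_set (gmod_act M g x)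
}.

Definition girreducible M :=
  (exists x : M, x != 0) /\
  forall S : subrep M, S = [set 0] :> set M \/ S = setT :> set M.

Section Sub.
Variables (M : gmod R G) (S : subrep M).

Definition subrep_pred : {pred M} := mem (subrep_set S).

HB.instance Definition _ :=
  GRing.isSubmodClosed.Build R M subrep_pred (subrep_submod S).

Record subrep_type := SubRepElt {
  subrep_val :> M; _ : subrep_val \in subrep_pred }.

HB.instance Definition _ := [isSub for subrep_val].
HB.instance Definition _ := [Choice of subrep_type by <:].
HB.instance Definition _ := [SubChoice_isSubLmodule of subrep_type by <:].

Fact sub_act_subproof g (x : subrep_type) :
  gmod_act M g (val x) \in subrep_pred.
Proof. by case: x => x hx /=; apply/mem_set/subrep_act/set_mem. Qed.

Definition sub_act g (x : subrep_type) : subrep_type :=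
  SubRepElt (sub_act_subproof g x).

Fact sub_act_linear g : linear (sub_act g).
Proof. by move=> a x y; apply: val_inj; rewrite /= linearP. Qed.

Fact sub_act1 x : sub_act 1%g x = x.
Proof. by apply: val_inj; rewrite /= gact1. Qed.

Fact sub_actM g h x : sub_act (g * h)%g x = sub_act g (sub_act h x).
Proof. by apply: val_inj; rewrite /= gactM. Qed.

Definition sub_gmod : gmod R G := GMod (GAction sub_act_linear sub_act1 sub_actM).

Definition quo_type : Type := Quotient.quot subrep_pred.

HB.instance Definition _ := GRing.Zmodule.on quo_type.
HB.instance Definition _ := @EqQuotient.on quo_type.

Local Notation q := (\pi_quo_type : M -> quo_type).

Lemma quo_eqP (x y : M) : reflect (q x = q y) (x - y \in subrep_pred).
Proof. by rewrite Quotient.idealrBE; apply: eqP. Qed.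

Lemma quo_repr (x : M) : repr (q x) - x \in subrep_pred.
Proof. by apply/quo_eqP; rewrite reprK. Qed.

Definition quo_scale (a : R) (x : quo_type) : quo_type := q (a *: repr x).

Lemma quo_scaleE a x : quo_scale a (q x) = q (a *: x).
Proof. by apply/quo_eqP; rewrite -scalerBr; apply: rpredZ; apply: quo_repr. Qed.

Fact quo_scaleA a b x : quo_scale a (quo_scale b x) = quo_scale (a * b) x.
Proof. by rewrite -[x]reprK (quo_scaleE b) 2!quo_scaleE scalerA. Qed.

Fact quo_scale1 : left_id 1 quo_scale.
Proof. by move=> x; rewrite -[x]reprK quo_scaleE scale1r. Qed.

Fact quo_scaleDr : right_distributive quo_scale +%R.
Proof.
move=> a x y; rewrite -[x]reprK -[y]reprK -raddfD !quo_scaleE -raddfD.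
by rewrite scalerDr.
Qed.

Fact quo_scaleDl x : {morph quo_scale^~ x : a b / a + b}.
Proof. by move=> a b; rewrite -[x]reprK !quo_scaleE scalerDl raddfD. Qed.

HB.instance Definition _ := GRing.Zmodule_isLmodule.Build R quo_type
  quo_scaleA quo_scale1 quo_scaleDr quo_scaleDl.

Lemma quo_pi_linear : linear q.
Proof. by move=> a x y; rewrite raddfD; congr (_ + _); apply/esym/quo_scaleE. Qed.

Definition quo_act g (x : quo_type) : quo_type := q (gmod_act M g (repr x)).

Lemma quo_actE g x : quo_act g (q x) = q (gmod_act M g x).
Proof.
apply/quo_eqP; rewrite -raddfB; apply/mem_set/subrep_act/set_mem.
exact: quo_repr.
Qed.

Fact quo_act_linear g : linear (quo_act g).
Proof.
move=> a x y; rewrite -[x]reprK -[y]reprK -quo_pi_linear (quo_actE g (repr x)).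
by rewrite (quo_actE g (repr y)) quo_actE -quo_pi_linear linearP.
Qed.

Fact quo_act1 x : quo_act 1%g x = x.
Proof. by rewrite -[x]reprK quo_actE gact1. Qed.

Fact quo_actM g h x : quo_act (g * h)%g x = quo_act g (quo_act h x).
Proof. by rewrite -[x]reprK (quo_actE h) 2!quo_actE gactM. Qed.

Definition quo_gmod : gmod R G := GMod (GAction quo_act_linear quo_act1 quo_actM).

Definition quo_proj (x : M) : quo_gmod := q x.

End Sub.

(* [subrep_res U0 U1] is U0 seen inside U1, i.e. U0 :&: U1. *)
Section SubQuotient.
Variables (M : gmod R G) (U0 U1 : subrep M).

Fact subrep_res_submod :
  submod_closed (mem [set x : sub_gmod U1 | subrep_set U0 (val x)]).
Proof.
have [h0 hD] := subrep_submod U0.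
split; first by rewrite inE /=; apply: set_mem h0.
by move=> a x y /set_mem hx /set_mem hy; apply/mem_set/set_mem/hD; apply/mem_set.
Qed.

Fact subrep_res_act g (x : sub_gmod U1) :
  subrep_set U0 (val x) -> subrep_set U0 (val (gmod_act (sub_gmod U1) g x)).
Proof. exact: subrep_act. Qed.

Definition subrep_res : subrep (sub_gmod U1) :=
  SubRep subrep_res_submod subrep_res_act.

(* U1 / U0, meaningful when U0 is contained in U1 *)
Definition subquo : gmod R G := quo_gmod subrep_res.

End SubQuotient.

Section DirectSum.
Variables (I : finType) (W : I -> gmod R G).

Definition dirsum_type : Type := {dffun forall i, W i}.

HB.instance Definition _ := Choice.on dirsum_type.

Implicit Types x y : dirsum_type.
Definition dirsum_mk (x : forall i, W i) : dirsum_type := [ffun i => x i].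
Definition dirsum_zero := dirsum_mk (fun i => 0).
Definition dirsum_opp x := dirsum_mk (fun i => - x i).
Definition dirsum_add x y := dirsum_mk (fun i => x i + y i).
Definition dirsum_scale (a : R) x := dirsum_mk (fun i => a *: x i).
Definition dirsum_act (g : G) x := dirsum_mk (fun i => gmod_act (W i) g (x i)).

Fact dirsum_addA : associative dirsum_add.
Proof. by move=> x y z; apply/ffunP => i; rewrite !ffunE addrA. Qed.
Fact dirsum_addC : commutative dirsum_add.
Proof. by move=> x y; apply/ffunP => i; rewrite !ffunE addrC. Qed.
Fact dirsum_add0 : left_id dirsum_zero dirsum_add.
Proof. by move=> x; apply/ffunP => i; rewrite !ffunE add0r. Qed.
Fact dirsum_addN : left_inverse dirsum_zero dirsum_opp dirsum_add.
Proof. by move=> x; apply/ffunP => i; rewrite !ffunE addNr. Qed.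

HB.instance Definition _ := GRing.isZmodule.Build dirsum_type
  dirsum_addA dirsum_addC dirsum_add0 dirsum_addN.

Fact dirsum_scaleA a b x :
  dirsum_scale a (dirsum_scale b x) = dirsum_scale (a * b) x.
Proof. by apply/ffunP => i; rewrite !ffunE scalerA. Qed.
Fact dirsum_scale1 : left_id 1 dirsum_scale.
Proof. by move=> x; apply/ffunP => i; rewrite !ffunE scale1r. Qed.
Fact dirsum_scaleDr : right_distributive dirsum_scale +%R.
Proof. by move=> a x y; apply/ffunP => i; rewrite !ffunE scalerDr. Qed.
Fact dirsum_scaleDl x : {morph dirsum_scale^~ x : a b / a + b}.
Proof. by move=> a b; apply/ffunP => i; rewrite !ffunE scalerDl. Qed.

HB.instance Definition _ := GRing.Zmodule_isLmodule.Build R dirsum_type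
  dirsum_scaleA dirsum_scale1 dirsum_scaleDr dirsum_scaleDl.

Fact dirsum_act_linear g : linear (dirsum_act g).
Proof. by move=> a x y; apply/ffunP => i; rewrite !ffunE linearP. Qed.
Fact dirsum_act1 x : dirsum_act 1%g x = x.
Proof. by apply/ffunP => i; rewrite !ffunE gact1. Qed.
Fact dirsum_actM g h x : dirsum_act (g * h)%g x = dirsum_act g (dirsum_act h x).
Proof. by apply/ffunP => i; rewrite !ffunE gactM. Qed.

Definition dirsum : gmod R G :=
  GMod (GAction dirsum_act_linear dirsum_act1 dirsum_actM).

End DirectSum.

Definition composition_series M (l : nat) (N : nat -> subrep M) :=
  [/\ N 0%N = [set 0] :> set M,
      N l = setT :> set M,
      forall k, (k < l)%N -> N k `<=` N k.+1
    & forall k, (k < l)%N -> girreducible (subquo (N k) (N k.+1))].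

(* S is isomorphic to the semisimplification of M: the direct sum of the
   factors of a composition series of M (unique up to isomorphism, by
   Jordan-Hoelder). *)
Definition is_semisimplification M (S : gmod R G) :=
  exists (l : nat) (N : nat -> subrep M), composition_series l N /\
    gisom S (dirsum (fun k : 'I_l => subquo (N k) (N k.+1))).

(* 0 -> B -f-> U -g-> A -> 0 *)
Definition short_exact (A B U : gmod R G) (f : ghom B U) (g : ghom U A) :=
  [/\ injective f, range f = g @^-1` [set 0] & range g = setT].

(* A representative [U, f, g] of a class in Ext(A, B). *)
Record extension (A B : gmod R G) := Extension {
  ext_mid : gmod R G;
  ext_inj : ghom B ext_mid;
  ext_proj : ghom ext_mid A;
  ext_exact : short_exact ext_inj ext_proj
}.

(* The two extensions define the same class in Ext(A, B). *)
Definition ext_equiv (A B : gmod R G) (E E' : extension A B) :=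
  exists phi : ghom (ext_mid E) (ext_mid E'),
    [/\ bijective phi,
        forall b, phi (ext_inj E b) = ext_inj E' b
      & forall u, ext_proj E' (phi u) = ext_proj E u].

Definition ext_split (A B : gmod R G) (E : extension A B) :=
  exists s : ghom A (ext_mid E), forall a, ext_proj E (s a) = a.

(* M has a subquotient U1 / U0 sitting in a short exact sequence which defines
   the class of E. *)
Definition mod_realises M (A B : gmod R G) (E : extension A B) :=
  exists U0 U1 : subrep M, U0 `<=` U1 /\
  exists (f : ghom B (subquo U0 U1)) (g : ghom (subquo U0 U1) A)
    (fg : short_exact f g), ext_equiv (Extension fg) E.

End GModules.

Section RestrictScalars.
Variables (K : cdvFieldType) (G : groupType) (V : lmodType K).

Definition resO : Type := V.

HB.instance Definition _ := GRing.Zmodule.on resO.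

Definition resO_scale (a : 'O_K) (x : resO) : resO := int_val a *: (x : V).

Fact resO_scaleA a b x : resO_scale a (resO_scale b x) = resO_scale (a * b) x.
Proof. exact: scalerA. Qed.
Fact resO_scale1 : left_id 1 resO_scale.
Proof. exact: scale1r. Qed.
Fact resO_scaleDr : right_distributive resO_scale +%R.
Proof. by move=> a; apply: scalerDr. Qed.
Fact resO_scaleDl x : {morph resO_scale^~ x : a b / a + b}.
Proof. by move=> a b; apply: scalerDl. Qed.

HB.instance Definition _ := GRing.Zmodule_isLmodule.Build 'O_K resO
  resO_scaleA resO_scale1 resO_scaleDr resO_scaleDl.

Variable rho : gaction G V.

Definition resO_act (g : G) (x : resO) : resO := rho g (x : V).
Fact resO_act_linear g : linear (resO_act g).
Proof. by move=> a x y; apply: (gact_linear rho). Qed.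
Fact resO_act1 x : resO_act 1%g x = x. Proof. exact: (gact1 rho). Qed.
Fact resO_actM g h x : resO_act (g * h)%g x = resO_act g (resO_act h x).
Proof. exact: (gactM rho). Qed.

Definition resO_gmod : gmod 'O_K G :=
  GMod (GAction resO_act_linear resO_act1 resO_actM).

End RestrictScalars.

(* An O_K[G]-module killed by the uniformiser, as a module over the residue
   field. *)
Section ToResidue.
Variables (K : cdvFieldType) (G : groupType) (M : gmod 'O_K G).
Variable Mpi0 : forall x : M, unifO *: x = 0.

Definition toF of (forall x : M, unifO *: x = 0) : Type := M.
Local Notation MF := (toF Mpi0).

HB.instance Definition _ := GRing.Zmodule.on MF.

Definition toF_scale (a : residue K) (x : MF) : MF := repr a *: (x : M).

Lemma max_ideal_unif (a : 'O_K) : a \in @max_ideal K -> exists b, a = b * unifO.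
Proof.
move=> ha; have hb : int_val a * unif^-1 \in @int_pred K.
  rewrite (_ : @int_pred K = val_ge dval (1 - 1)) //; apply: val_geM => //.
  rewrite unfold_in invr_eq0 (negPf unif_neq0) /=.
  have : dval (unif : K) + dval (unif^-1 : K) = 0.
    by rewrite -dvalM ?invr_eq0 ?unif_neq0 // divff ?unif_neq0 // dval1.
  by rewrite dval_unif => /eqP; rewrite addrC addr_eq0 => /eqP ->.
by exists (Integers hb); apply: val_inj; rewrite /= mulfVK ?unif_neq0.
Qed.

Lemma toF_scaleE (a : 'O_K) (x : MF) :
  toF_scale (\pi_(residue K) a) x = a *: (x : M).
Proof.
apply/eqP; rewrite -subr_eq0 -scalerBl.
have /max_ideal_unif[b ->] : repr (\pi_(residue K) a) - a \in @max_ideal K.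
  by rewrite Quotient.idealrBE reprK.
by rewrite -scalerA Mpi0 scaler0.
Qed.

Fact toF_scaleA a b x : toF_scale a (toF_scale b x) = toF_scale (a * b) x.
Proof. by rewrite -[a]reprK -[b]reprK -rmorphM !toF_scaleE scalerA. Qed.
Fact toF_scale1 : left_id 1 toF_scale.
Proof. by move=> x; rewrite -(rmorph1 \pi_(residue K)) toF_scaleE scale1r. Qed.
Fact toF_scaleDr : right_distributive toF_scale +%R.
Proof. by move=> a x y; apply: scalerDr. Qed.
Fact toF_scaleDl x : {morph toF_scale^~ x : a b / a + b}.
Proof.
by move=> a b; rewrite -[a]reprK -[b]reprK -raddfD !toF_scaleE scalerDl.
Qed.

HB.instance Definition _ := GRing.Zmodule_isLmodule.Build (residue K) MF
  toF_scaleA toF_scale1 toF_scaleDr toF_scaleDl.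

Definition toF_act (g : G) (x : MF) : MF := gmod_act M g (x : M).
Fact toF_act_linear g : linear (toF_act g).
Proof. by move=> a x y; apply: (gact_linear (gmod_act M)). Qed.
Fact toF_act1 x : toF_act 1%g x = x. Proof. exact: (gact1 (gmod_act M)). Qed.
Fact toF_actM g h x : toF_act (g * h)%g x = toF_act g (toF_act h x).
Proof. exact: (gactM (gmod_act M)). Qed.

Definition toF_gmod : gmod (residue K) G :=
  GMod (GAction toF_act_linear toF_act1 toF_actM).

End ToResidue.

Section Lattices.
Variables (K : cdvFieldType) (G : groupType) (V : vectType K).

Definition is_lattice (L : set V) :=
  exists b : 'I_(\dim {: V}) -> V,
    (forall a : 'I_(\dim {: V}) -> 'O_K,
       \sum_i int_val (a i) *: b i = 0 -> forall i, a i = 0) /\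
    L = [set \sum_i int_val (a i) *: b i | a in [set: 'I_(\dim {: V}) -> 'O_K]].

Variable rho : gaction G V.

Record stable_lattice := StableLattice {
  lat_set :> set V;
  lat_lattice : is_lattice lat_set;
  lat_stable : forall g, rho g @` lat_set = lat_set
}.

Section Reduction.
Variable L : stable_lattice.

Fact lat_submod : submod_closed (mem (lat_set L : set (resO_gmod rho))).
Proof.
have [b [_ Lb]] := lat_lattice L.
split.
  apply/mem_set; rewrite Lb; exists (fun=> 0) => //.
  by rewrite big1 // => i _; rewrite scale0r.
move=> c x y /set_mem; rewrite {1}Lb => -[a _ <-] /set_mem; rewrite {1}Lb.
move=> -[a' _ <-]; apply/mem_set; rewrite Lb.
exists (fun i => c * a i + a' i) => //.
rewrite [_ *: _]scaler_sumr -big_split /=; apply: eq_bigr => i _.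
by rewrite scalerDl scalerA.
Qed.

Fact lat_act g x : lat_set L x -> lat_set L (rho g x).
Proof. by move=> hx; rewrite -(lat_stable L g); exists x. Qed.

Definition lat_subrep : subrep (resO_gmod rho) :=
  @SubRep _ _ (resO_gmod rho) (lat_set L) lat_submod lat_act.

Definition lat_gmod : gmod 'O_K G := sub_gmod lat_subrep.

Fact pi_lat_submod : submod_closed (mem [set unifO *: x | x in [set: lat_gmod]]).
Proof.
split; first by apply/mem_set; exists 0 => //; rewrite scaler0.
move=> a x y /set_mem[x' _ <-] /set_mem[y' _ <-]; apply/mem_set.
exists (a *: x' + y') => //.
by rewrite scalerDr !scalerA mulrC.
Qed.

Fact pi_lat_act g x : [set unifO *: x | x in [set: lat_gmod]] x ->
  [set unifO *: x | x in [set: lat_gmod]] (gmod_act lat_gmod g x).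
Proof. by case=> y _ <-; exists (gmod_act lat_gmod g y) => //; rewrite linearZ. Qed.

Definition pi_lat : subrep lat_gmod := SubRep pi_lat_submod pi_lat_act.

Fact quo_pi_lat_killed (x : quo_gmod pi_lat) : unifO *: x = 0.
Proof.
rewrite -[x]reprK [_ *: _]quo_scaleE -[RHS](raddf0 \pi_(quo_type pi_lat)).
by apply/quo_eqP; rewrite subr0; apply/mem_set; exists (repr x).
Qed.

Definition reduction : gmod (residue K) G := toF_gmod quo_pi_lat_killed.

Definition red_map (x : lat_gmod) : reduction := quo_proj pi_lat x.

Definition normalised (v : V) :=
  v != 0 /\ exists x : lat_gmod, val x = v /\ red_map x != 0.

End Reduction.

Definition maximal_at (L : stable_lattice) (v : V) :=
  normalised L v /\
  forall L' : stable_lattice, normalised L' v -> L `<=` L' ->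
    L' = L :> set V.

Definition maximal_lattice (L : stable_lattice) :=
  exists v : V, maximal_at L v.

Definition lat_realises (L : stable_lattice) (A B : gmod (residue K) G)
    (E : extension A B) :=
  mod_realises (reduction L) E.

Definition rep_realises (A B : gmod (residue K) G) (E : extension A B) :=
  exists L : stable_lattice, lat_realises L E.

(* S is isomorphic to the semisimplified reduction of rho, which does not depend
   on the stable lattice used to compute it (Brauer-Nesbitt). *)
Definition is_reduction_ss (S : gmod (residue K) G) :=
  exists L : stable_lattice, is_semisimplification (reduction L) S.

End Lattices.

(* Main.v *)
Require Import Defs.
From HB Require Import structures.
From mathcomp Require Import all_boot all_order all_algebra.
From mathcomp Require Import boolp classical_sets.
From mathcomp Require Import generic_quotient ring.

(**
Let [L] be a stable lattice with [U = U1 / U0], [U0 <= U1 <= L / pi L], and let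
[A <= N <= L] be the preimages of [U0 <= U1]. Since [pi N <= pi L <= A], the map
[x |-> pi x] identifies [U = N / A] with the submodule [pi N / pi A] of
[A / pi A]. Pick [x0] in [N] lifting a nonzero element of the submodule [W_j] of
[U], and put [v = pi x0]: then [v] is in [A], and [pi^-1 v] is not.

By Zorn there is a stable O_K-submodule [B] of [V] containing [A] and maximal
for not containing [pi^-1 v]. An O_K-submodule of [V] is either finite free or
contains a K-line, by completeness of [K]; as the union of the K-lines in [B] is
a subrepresentation of [V] and [B <> V], irreducibility shows that [B] is a
lattice, maximal with respect to [v].

The induced map [U -> B / pi B], [x |-> pi x], does not kill [W_j]; as [W_i] and
[W_j] are irreducible and the extension is non-split, it is injective.
*)

Set Implicit Arguments.
Unset Strict Implicit.
Unset Printing Implicit Defensive.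

Import Order.TTheory GRing.Theory Num.Theory.
Local Open Scope ring_scope.
Local Open Scope classical_set_scope.
Local Open Scope quotient_scope.

(** * Valuation estimates and pi-adic series *)

Section Valuation.
Variable K : cdvFieldType.
Implicit Types (x y : K) (N : int).

Lemma val_ge0 N : (0 : K) \in val_ge dval N.
Proof. by rewrite unfold_in eqxx. Qed.

Lemma val_geW N N' x : N' <= N -> x \in val_ge dval N -> x \in val_ge dval N'.
Proof. by rewrite !unfold_in => h /orP[->|/(le_trans h)->]; rewrite ?orbT. Qed.

Lemma val_geN N x : x \in val_ge dval N -> - x \in val_ge dval N.
Proof.
move=> hx; rewrite -mulN1r -[N]add0r; apply: val_geM => //.
by rewrite unfold_in dvalN1 lexx orbT.
Qed.

Lemma val_geB N x y :
  x \in val_ge dval N -> y \in val_ge dval N -> x - y \in val_ge dval N.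
Proof. by move=> hx hy; apply/val_geD/val_geN. Qed.

Lemma val_ge_eq0 x : (forall N, x \in val_ge dval N) -> x = 0.
Proof.
move=> /(_ (dval x + 1)); rewrite unfold_in => /orP[/eqP//|].
by rewrite gerDl.
Qed.

Lemma dvalV x : x != 0 -> dval x^-1 = - dval x.
Proof.
move=> x0; have xV0 : x^-1 != 0 by rewrite invr_eq0.
have := dvalM _ _ xV0 x0; rewrite mulVf // dval1.
by move/esym/eqP; rewrite addr_eq0 => /eqP.
Qed.

Lemma dvalX x n : x != 0 -> dval (x ^+ n) = dval x *+ n.
Proof.
move=> x0; elim: n => [|n IH]; first by rewrite expr0 dval1.
by rewrite exprS dvalM ?expf_neq0 // IH mulrS.
Qed.

Lemma val_ge_unifX n : (unif : K) ^+ n \in val_ge dval n%:Z.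
Proof.
rewrite unfold_in dvalX ?unif_neq0 // dval_unif.
by rewrite -natz lexx orbT.
Qed.

Lemma int_valP (a : integers K) : int_val a \in val_ge dval 0.
Proof. by case: a. Qed.

(* [A k] is the sum of the series [a k + pi a (k+1) + pi^2 a (k+2) + ...]. *)
Lemma unif_series (a : nat -> integers K) :
  exists A : nat -> integers K, forall k, A k = a k + unifO * A k.+1.
Proof.
pose S k n : K := \sum_(m < n) unif ^+ m * int_val (a (k + m)%N).
have Sint k n : S k n \in val_ge dval 0.
  rewrite /S; elim/big_ind: _ => [|x y|m _]; [exact: val_ge0|exact: val_geD|].
  rewrite -[0]addr0; apply: val_geM (int_valP _).
  exact: val_geW (val_ge_unifX m).
have tail k n d : S k (n + d)%N - S k n \in val_ge dval n%:Z.
  rewrite /S big_split_ord /= addrAC subrr add0r.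
  elim/big_ind: _ => [|x y|m _]; [exact: val_ge0|exact: val_geD|].
  rewrite -[n%:Z]addr0; apply: val_geM (int_valP _).
  by apply: val_geW (val_ge_unifX _); rewrite lez_nat leq_addr.
have cauchy k : val_cauchy dval (S k).
  move=> N; exists `|N|%N => p q hp hq.
  have NN : N <= `|N|%N%:Z by rewrite abszE ler_norm.
  apply: (val_geW NN).
  rewrite -(subrKA (S k `|N|%N)) -[_ - S k q]opprB; apply: val_geB.
    by rewrite -(subnKC hp); apply: tail.
  by rewrite -(subnKC hq); apply: tail.
have lim k : exists l : integers K, val_cvg dval (S k) (int_val l).
  have [l hl] := dval_complete (S k) (cauchy k).
  have lint : l \in @int_pred K.
    have [n0 /(_ n0 (leqnn _)) h] := hl 0.
    by have := val_geB (Sint k n0) h; rewrite subKr.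
  by exists (Integers lint).
have [A hA] := choice lim; exists A => k.
apply: val_inj => /=; apply/eqP; rewrite -subr_eq0; apply/eqP/val_ge_eq0 => N.
(* Precision [N - 1] suffices for the second limit, because the factor [unif] raises valuations by
   one. *)
have [n1 h1] := hA k N; have [n2 h2] := hA k.+1 (N - 1).
pose n := maxn n1 n2.
have {}h1 : S k n.+1 - int_val (A k) \in val_ge dval N.
  by apply: h1; rewrite (leq_trans (leq_maxl _ n2)) // leqnSn.
have {}h2 : unif * (S k.+1 n - int_val (A k.+1)) \in val_ge dval N.
  have -> : N = 1 + (N - 1) by rewrite addrC subrK.
  apply: val_geM; last by apply: h2; rewrite leq_maxr.
  exact: (val_ge_unifX 1).
have SS : S k n.+1 = int_val (a k) + unif * S k.+1 n.
  rewrite /S big_ord_recl expr0 mul1r addn0; congr (_ + _).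
  rewrite mulr_sumr; apply: eq_bigr => m _.
  by rewrite exprS mulrA /bump /= addnS addSn.
have := val_geB h2 h1; rewrite SS.
suff -> : forall s l b t : K, unif * (s - l) - (b + unif * s - t) = t - (b + unif * l).
  by [].
by move=> s l b t; ring.
Qed.

End Valuation.

(** * O_K-submodules of V: a K-line or a finite basis *)

Section IntegralSubmodules.
Variables (K : cdvFieldType) (V : vectType K).
Implicit Types (L : set V) (X : seq V).

Definition int_submod L :=
  L 0 /\ forall a x y, a \in @int_pred K -> L x -> L y -> L (a *: x + y).

(** Coefficient families live on all of [nat], so that passing between [X] and [x :: X] is a shift
    of indices; values from [size X] on are ignored. *)
Definition int_span X : set V :=
  [set \sum_(i < size X) int_val (a i) *: X`_i | a in [set: nat -> integers K]].

Definition has_line L := exists2 z : V, z != 0 & forall c, L (c *: z).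

Lemma int_submodZ L a x :
  int_submod L -> a \in @int_pred K -> L x -> L (a *: x).
Proof. by case=> L0 LD ha hx; rewrite -[_ *: _]addr0; apply: LD. Qed.

Lemma int_submodD L x y : int_submod L -> L x -> L y -> L (x + y).
Proof. by case=> _ LD hx hy; rewrite -[x]scale1r; apply: LD => //; apply: rpred1. Qed.

Lemma int_span_nth X i : (i < size X)%N -> int_span X X`_i.
Proof.
move=> hi; exists (fun k => (k == i)%:R) => //.
rewrite (bigD1 (Ordinal hi)) //= eqxx rmorph1 scale1r big1 ?addr0 // => k.
by rewrite -val_eqE /= => /negPf->; rewrite rmorph0 scale0r.
Qed.

(** The valuations of the nonzero values of [p] on [L] are integers bounded below by [N], so the
    least one is attained, and a value of least valuation divides all the others in O_K. *)
Lemma val_ge_min L (p : V -> K) N :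
    (exists2 x, L x & p x != 0) -> (forall x, L x -> p x \in val_ge dval N) ->
  exists x, [/\ L x, p x != 0 & forall y, L y -> p y / p x \in @int_pred K].
Proof.
move=> [x0 Lx0 px0] hN.
pose Q n := `[< exists x, [/\ L x, p x != 0 & dval (p x) = N + n%:Z] >].
have valN x : L x -> p x != 0 -> exists n : nat, dval (p x) = N + n%:Z.
  move=> Lx px; have := hN x Lx; rewrite unfold_in (negPf px) /= => h.
  by exists `|dval (p x) - N|%N; rewrite gez0_abs ?subr_ge0 // [N + _]addrC subrK.
have exQ : exists n, Q n.
  by have [n hn] := valN _ Lx0 px0; exists n; apply/asboolP; exists x0.
case: (ex_minnP exQ) => n /asboolP[x [Lx px hx]] min_n; exists x; split=> // y Ly.
rewrite unfold_in; have [|py0] := eqVneq (p y) 0; first by move->; rewrite mul0r eqxx.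
rewrite dvalM ?invr_eq0 // dvalV // subr_ge0; apply/orP; right.
have [m hm] := valN _ Ly py0; rewrite hm hx lerD2l lez_nat; apply: min_n.
by apply/asboolP; exists y.
Qed.

(* If [p] is unbounded on [L], pick [x k] in [L] with [p (x k) = pi^-k]. The
   defects [pi x (k+1) - x k] lie in the finite free module [L /\ ker p], so by
   completeness they can be corrected by elements of [L /\ ker p], after which
   [pi x (k+1) = x k] and [x 0] spans a line in [L]. *)
Lemma unbounded_has_line L (p : V -> K) X :
    linear_for *%R p -> int_submod L ->
    [set x | L x /\ p x = 0] = int_span X ->
    (forall N, exists2 x, L x & p x \notin val_ge dval N) ->
  has_line L.
Proof.
move=> plin Lsub LX unb.
have p0 : p 0 = 0 by have := plin (-1) 0 0; rewrite scaler0 addr0 mulN1r addNr.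
have pZ a x : p (a *: x) = a * p x by rewrite -[_ *: x]addr0 plin p0 addr0.
have pD x y : p (x + y) = p x + p y by rewrite -[x]scale1r plin mul1r scale1r.
have u0 := @unif_neq0 K.
(* Some value of [p] has valuation below [-k]; an integral multiple of it is exactly [pi^-k]. *)
have ex_x k : exists x, L x /\ p x = unif ^- k.
  have [x Lx] := unb (- k%:Z); rewrite unfold_in negb_or -ltNge => /andP[px hx].
  exists ((unif ^- k / p x) *: x); split; last by rewrite pZ mulfVK.
  apply: int_submodZ => //; rewrite unfold_in; apply/orP; right.
  rewrite dvalM ?invr_eq0 ?expf_neq0 // !dvalV ?expf_neq0 // dvalX // dval_unif.
  by rewrite subr_ge0 natz ltW.
have {ex_x} [x hx] := choice ex_x.
have ex_a k : exists a : nat -> integers K,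
    \sum_(i < size X) int_val (a i) *: X`_i = unif *: x k.+1 - x k.
  suff: int_span X (unif *: x k.+1 - x k) by case=> a _ <-; exists a.
  rewrite -LX /=; have [Lx px] := hx k; have [Lx' px'] := hx k.+1; split.
    apply: int_submodD => //; last first.
      by rewrite -scaleN1r; apply: int_submodZ; rewrite ?rpredN1.
    by apply: int_submodZ => //; apply: unif_int_subproof.
  rewrite pD -scaleN1r !pZ px px' exprS invfM mulrA mulfV // mul1r mulN1r.
  by rewrite subrr.
have {ex_a} [a ha] := choice ex_a.
(* The series are summed separately along each vector of [X]; the relation
   [A i k = a k i + pi A i (k+1)] is what absorbs the defect at [k]. *)
have [A hA] := choice (fun i => unif_series (fun k => a k i)).
pose z k := x k + \sum_(i < size X) int_val (A i k) *: X`_i.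
have inL0 k : L (\sum_(i < size X) int_val (A i k) *: X`_i) /\
              p (\sum_(i < size X) int_val (A i k) *: X`_i) = 0.
  suff: int_span X (\sum_(i < size X) int_val (A i k) *: X`_i) by rewrite -LX.
  by exists (A^~ k).
have Lz k : L (z k) by have [? _] := inL0 k; apply: int_submodD => //; case: (hx k).
have zS k : z k = unif *: z k.+1.
  rewrite /z scalerDr -[unif *: x _](subrK (x k)) -ha [_ + x k]addrC -addrA.
  congr (_ + _); rewrite scaler_sumr -big_split; apply: eq_bigr => i _ /=.
  by rewrite scalerA -scalerDl hA.
have z0 k : z 0%N = unif ^+ k *: z k.
  elim: k => [|k ->]; first by rewrite expr0 scale1r.
  by rewrite {1}zS scalerA exprSr.
exists (z 0%N).
  apply/eqP => /(congr1 p); have [_ h0] := inL0 0%N; rewrite pD h0 p0 addr0.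
  by have [_ ->] := hx 0%N; rewrite expr0 invr1 => /eqP; rewrite oner_eq0.
move=> c; have [-> | c0] := eqVneq c 0; first by rewrite scale0r; case: Lsub.
(* For [n = |dval c|] the scalar [c pi^n] is integral, even if [c] is not. *)
rewrite (z0 `|dval c|%N) scalerA; apply: int_submodZ => //.
rewrite unfold_in dvalM ?expf_neq0 // dvalX // dval_unif natz abszE.
by rewrite -lerBlDl sub0r (le_trans (ler_norm _)) ?normrN ?orbT.
Qed.

(** Induction on the number of functionals separating the points of [L]. The kernel in [L] of the
    last one is separated by the others. If this kernel is free, an unbounded last functional
    produces a line, while a bounded nonzero one splits [L] as O_K [x] plus the kernel, where [x]
    gives it a value of least valuation. *)
Lemma has_line_or_free_sep L n (p : nat -> V -> K) :
    (forall i, linear_for *%R (p i)) -> int_submod L ->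
    (forall x, L x -> (forall i, (i < n)%N -> p i x = 0) -> x = 0) ->
  has_line L \/ exists2 X, free X & L = int_span X.
Proof.
move=> plin; elim: n L => [|n IHn] L Lsub sepL.
  right; exists [::]; first exact: nil_free.
  apply/seteqP; split=> x.
    by move/sepL=> -> //; exists (fun=> 0); rewrite ?big_ord0.
  by case=> a _ <-; rewrite big_ord0; case: Lsub.
have p0 : p n 0 = 0 by have := plin n (-1) 0 0; rewrite scaler0 addr0 mulN1r addNr.
have pZ a x : p n (a *: x) = a * p n x.
  by rewrite -[_ *: x]addr0 plin p0 addr0.
pose L0 := [set x | L x /\ p n x = 0].
have L0sub : int_submod L0.
  case: (Lsub) => h0 hD; split=> // a x y ha [Lx px] [Ly py]; split; first exact: hD.
  by rewrite plin px py mulr0 addr0.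
have sepL0 x : L0 x -> (forall i, (i < n)%N -> p i x = 0) -> x = 0.
  case=> Lx px h; apply: sepL => // i; rewrite ltnS leq_eqVlt.
  by case/orP=> [/eqP->//|/h].
have [[z z0 hz]|[X freeX L0X]] := IHn _ L0sub sepL0.
  by left; exists z => // c; case: (hz c).
have [[N hN]|unb] := pselect (exists N, forall x, L x -> p n x \in val_ge dval N);
  last first.
  left; apply: (unbounded_has_line (plin n) Lsub L0X) => N.
  apply: contrapT => h; apply: unb; exists N => x Lx; apply: contrapT => /negP hx.
  by apply: h; exists x.
right; have [nz|z] := pselect (exists2 x, L x & p n x != 0); last first.
  exists X => //; rewrite -L0X; apply/seteqP; split=> [x Lx|x []//]; split=> //.
  by apply/eqP/negPn/negP => px; apply: z; exists x.
have [x [Lx px hx]] := val_ge_min nz hN.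
exists (x :: X).
  rewrite free_cons freeX andbT; apply: contra px => xX.
  rewrite (@coord_span _ _ _ (in_tuple X) x xX); apply/eqP.
  have: (forall i : 'I_(size X), p n X`_i = 0).
    by move=> i; have := int_span_nth (ltn_ord i); rewrite -L0X => -[].
  move=> h; elim/big_ind: _ => [//|y z hy hz|i _]; last by rewrite pZ h mulr0.
  by rewrite -[y]scale1r plin hy hz mulr0 addr0.
apply/seteqP; split=> y.
  move=> Ly; have hyx := hx _ Ly.
  have : L0 (- (p n y / p n x) *: x + y).
    split; first by case: Lsub => _; apply=> //; rewrite rpredN.
    by rewrite plin mulNr mulfVK // addNr.
  rewrite L0X => -[a _ ha].
  exists (fun i => if i is i'.+1 then a i' else Integers hyx) => //=.
  by rewrite big_ord_recl /= ha scaleNr addrA subrr add0r.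
case=> a _ <-; rewrite /= big_ord_recl /=; case: Lsub => _; apply=> //.
  exact: int_valP.
suff []: L0 (\sum_(i < size X) int_val (a i.+1) *: X`_i) by [].
by rewrite L0X; exists (fun i => a i.+1).
Qed.

Lemma has_line_or_free L :
  int_submod L -> has_line L \/ exists2 X, free X & L = int_span X.
Proof.
move=> Lsub; pose b := vbasis {:V}.
(* Coordinates in a basis of [V], continued by the zero functional from the dimension on. *)
pose p i x := if insub i is Some j then coord b j x else 0.
apply: (@has_line_or_free_sep L (\dim {:V}) p) => //.
  by move=> i a x y; rewrite /p; case: insub => [j|]; rewrite ?linearP ?mulr0 ?addr0.
move=> x _ hx; rewrite (coord_vbasis (memvf x)) big1 // => j _.
by have := hx j (ltn_ord j); rewrite /p valK => ->; rewrite scale0r.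
Qed.

End IntegralSubmodules.

(** * Stable submodules, lattices and maximality *)

Section StableSubmodules.
Variables (K : cdvFieldType) (G : groupType) (V : vectType K).
Variables (rho : gaction G V) (rho_irr : girreducible (GMod rho)).
Implicit Types (A : set V) (v : V).

Definition stable_submod A :=
  int_submod A /\ forall g x, A x -> A (rho g x).

(** Irreducibility for bare sets; it is applied to the union of the lines in a stable submodule and
    to the K-span of a stable submodule. *)
Lemma irr_full (D : set V) z : z != 0 -> D z -> D 0 ->
    (forall a x y, D x -> D y -> D (a *: x + y)) ->
    (forall g x, D x -> D (rho g x)) ->
  D = setT.
Proof.
move=> z0 Dz D0 DD Dg.
have Dsub : submod_closed (mem (D : set (GMod rho))).
  split; first exact: mem_set.
  by move=> a x y /set_mem hx /set_mem hy; apply/mem_set/DD.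
case: rho_irr => _ /(_ (@SubRep _ _ (GMod rho) D Dsub Dg))[/= D1|//].
by move: Dz; rewrite D1 /= => /eqP; rewrite (negPf z0).
Qed.

Lemma stable_has_line A : stable_submod A -> has_line A -> A = setT.
Proof.
move=> [Asub Ag] [z z0 hz].
suff D : [set x | forall c : K, A (c *: x)] = setT.
  apply/seteqP; split=> // x _.
  have : [set x | forall c : K, A (c *: x)] x by rewrite D.
  by move/(_ 1); rewrite scale1r.
apply: (irr_full z0) => //=.
- by move=> c; rewrite scaler0; case: Asub.
- move=> a x y hx hy c; rewrite scalerDr scalerA.
  by apply: int_submodD (hx _) (hy _).
by move=> g x hx c; rewrite -linearZ; apply: Ag.
Qed.

(** The action sends each vector of [X] into [int_span X], so the K-span of [X] is a nonzero
    subrepresentation, hence all of [V]. Thus [X] has the length [\dim {:V}] that [is_lattice]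
    demands. *)
Lemma stable_span_lattice X : X != [::] -> free X -> stable_submod (int_span X) ->
  is_lattice (int_span X).
Proof.
move=> X0 freeX [_ Xg].
have spanX : [set x : V | x \in <<X>>%VS] = setT.
  have X00 : (0 < size X)%N by case: (X) X0.
  have Xs y : int_span X y -> y \in <<X>>%VS.
    case=> a _ <-; apply: memv_suml => i _; apply/memvZ/memv_span.
    by rewrite mem_nth.
  apply: (irr_full (z := X`_0)); rewrite /= ?mem0v //.
  - by apply: contraTneq freeX => X0e; apply/negP => /free_not0/(_ (mem_nth 0 X00));
      rewrite X0e eqxx.
  - by apply/memv_span/mem_nth.
  - by move=> a x y hx hy; rewrite memvD // memvZ.
  move=> g x hx; rewrite (@coord_span _ _ _ (in_tuple X) x hx) linear_sum.
  apply: memv_suml => i _; rewrite linearZ; apply/memvZ/Xs/Xg.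
  exact: int_span_nth.
have szX : size X = \dim {:V}.
  have -> : {:V}%VS = <<X>>%VS.
    apply/eqP; rewrite eqEsubv subvf andbT; apply/subvP => x _.
    by have : [set x : V | x \in <<X>>%VS] x by rewrite spanX.
  by apply/esym/eqP.
exists (fun i => X`_i); split.
  move=> a ha i; apply: val_inj => /=.
  have /freeP h : free (Tuple (introT eqP szX)) by [].
  exact: (h (fun i => int_val (a i))).
apply/seteqP; split=> x; rewrite /int_span szX; case=> a _ <-.
  by exists (fun i => a i).
exists (fun i => if insub i is Some j then a j else 0) => //.
by apply: eq_bigr => i _; rewrite valK.
Qed.

Lemma stable_is_lattice A :
  stable_submod A -> A <> setT -> A <> [set 0] -> is_lattice A.
Proof.
move=> As AT A0; have [Asub Ag] := As.
have [/(stable_has_line As)//|[X freeX AX]] := has_line_or_free Asub.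
rewrite AX in As *; apply: stable_span_lattice => //.
apply/eqP => X0; apply: A0; rewrite AX X0.
apply/seteqP; split=> x; first by case=> a _ <-; rewrite big_ord0.
by move->; exists (fun=> 0); rewrite ?big_ord0.
Qed.

Lemma stable_image A g : (forall g x, A x -> A (rho g x)) -> rho g @` A = A.
Proof.
move=> Ag; apply/seteqP; split=> x; first by case=> y Ay <-; apply: Ag.
move=> Ax; exists (rho g^-1%g x); first exact: Ag.
by rewrite -gactM mulgV gact1.
Qed.

Lemma stable_submod_lattice (L : stable_lattice rho) : stable_submod L.
Proof.
have [L0 LD] := lat_submod L; split; last exact: lat_act.
split=> [|a x y ha Lx Ly]; first exact: set_mem L0.
have := LD (Integers ha) (x : resO V) y; rewrite !in_setE; exact.
Qed.

Lemma red_map_eq0 (L : stable_lattice rho) (x : lat_gmod L) :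
  red_map x = 0 <-> lat_set L (unif^-1 *: (val x : V)).
Proof.
have u0 := @unif_neq0 K.
have -> : (red_map x = 0) <-> x - 0 \in subrep_pred (pi_lat L).
  split=> [h|/quo_eqP h]; last by rewrite /red_map /quo_proj h raddf0.
  by apply/quo_eqP; rewrite raddf0.
rewrite subr0; split.
  move=> /set_mem[y _ <-]; rewrite [val _]/= [_ *: _]scalerA mulVf // scale1r.
  by case: y => y hy; apply: set_mem.
move=> h; apply: mem_set.
have h' : unif^-1 *: (val x : V) \in subrep_pred (lat_subrep L) by exact: mem_set.
exists (SubRepElt h') => //; apply: val_inj.
by rewrite /= [LHS]scalerA mulfV // scale1r.
Qed.

(** Both conditions on the right pass to unions of nonempty chains, which makes this form fit for
    Zorn's lemma. *)
Lemma normalisedE (L : stable_lattice rho) v :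
  normalised L v <-> lat_set L v /\ ~ lat_set L (unif^-1 *: v).
Proof.
split=> [[v0 [x [<- /eqP hx]]]|[Lv Lv']].
  by split; [case: x {hx} => x hx; apply: set_mem | move/red_map_eq0].
split.
  by apply/eqP => v0; apply: Lv'; rewrite v0 scaler0 -v0.
have hv : v \in subrep_pred (lat_subrep L) by apply: mem_set.
by exists (SubRepElt hv); split=> //; apply/eqP => /red_map_eq0.
Qed.

Lemma exists_maximal_above A v :
    stable_submod A -> A v -> ~ A (unif^-1 *: v) ->
  exists2 L : stable_lattice rho, maximal_at L v & A `<=` L.
Proof.
move=> As Av Av'.
pose good B := [/\ stable_submod B, A `<=` B & ~ B (unif^-1 *: v)].
have goodA : good A by split.
have [B [PB maxB]] : exists B, (B = set0 \/ good B) /\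
    forall C, B `<` C -> ~ (C = set0 \/ good C).
  apply: Zorn_bigcup => F FP Ftot.
  have [[B0 FB0 [b0 Bb0]]|F0] := pselect (exists2 B0, F B0 & B0 !=set0); last first.
    left; apply/seteqP; split=> // x [B FB Bx]; apply: F0; exists B => //.
    by exists x.
  have Fgood B x : F B -> B x -> good B.
    by move=> FB Bx; case: (FP _ FB) => // B_0; rewrite B_0 in Bx.
  have [[[B00 _] _] AB0 _] := Fgood _ _ FB0 Bb0.
  right; split; first split; first split.
  - by exists B0.
  - move=> a x y ha [B FB Bx] [C FC Cy].
    have [BC|CB] := Ftot _ _ FB FC.
      exists C => //; have [[[_ CD] _] _ _] := Fgood _ _ FC Cy.
      by apply: CD => //; apply: BC.
    exists B => //; have [[[_ BD] _] _ _] := Fgood _ _ FB Bx.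
    by apply: BD => //; apply: CB.
  - move=> g x [B FB Bx]; exists B => //.
    by have [[_ Bg] _ _] := Fgood _ _ FB Bx; apply: Bg.
  - by move=> x Ax; exists B0 => //; apply: AB0.
  by case=> B FB Bv; have [_ _] := Fgood _ _ FB Bv; apply.
have {PB} [Bs AB Bv'] : good B.
  case: PB => // B0; have : B `<` A.
    by split; rewrite B0 // => /(_ _ Av).
  by move/maxB; case; right.
have Blat : is_lattice B.
  apply: stable_is_lattice => //; first by move=> BT; apply: Bv'; rewrite BT.
  move=> B0; apply: Bv'; have := AB _ Av; rewrite B0 /= => ->.
  by rewrite scaler0.
exists (StableLattice Blat (fun g => stable_image g Bs.2)) => //.
split; first by apply/normalisedE; split => //; apply: AB.
(* A stable lattice normalised at [v] and containing [B] is itself good, so it cannot be strictly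
   larger. *)
move=> L /normalisedE[Lv Lv'] BL; apply: contrapT => neq.
have : B `<` L by split=> // LB; apply: neq; apply/seteqP.
move/maxB; apply; right; split => //; first exact: stable_submod_lattice.
exact: subset_trans BL.
Qed.

End StableSubmodules.

(** * Homomorphisms, subquotients and non-split extensions *)

Section Homs.
Variables (R : nzRingType) (G : groupType).
Implicit Types M N P : gmod R G.

Lemma subrep0 M (S : subrep M) : subrep_set S 0.
Proof. by case: (subrep_submod S) => /set_mem. Qed.

Lemma subrepP M (S : subrep M) a x y :
  subrep_set S x -> subrep_set S y -> subrep_set S (a *: x + y).
Proof.
by move=> hx hy; case: (subrep_submod S) => _ h; apply/set_mem/h; apply/mem_set.
Qed.

Lemma comp_ghom M N P (f : ghom N P) (g : ghom M N) :
  exists k : ghom M P, k =1 f \o g.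
Proof.
have klin : linear (f \o g) by move=> a x y; rewrite /= !linearP.
have kact x y : (f \o g) (gmod_act M x y) = gmod_act P x ((f \o g) y).
  by rewrite /= !ghom_act.
by exists (GHom klin kact).
Qed.

Lemma inv_ghom M N (f : ghom M N) : bijective f ->
  exists2 k : ghom N M, cancel f k & cancel k f.
Proof.
case=> k fk kf.
have klin : linear k.
  by move=> a x y; apply: (can_inj fk); rewrite linearP /= !kf.
have kact g x : k (gmod_act N g x) = gmod_act M g (k x).
  by apply: (can_inj fk); rewrite ghom_act !kf.
by exists (GHom klin kact).
Qed.

Lemma quo_proj_linear M (S : subrep M) : linear (@quo_proj R G M S).
Proof. exact: quo_pi_linear. Qed.

Lemma quo_proj_act M (S : subrep M) g x :
  quo_proj S (gmod_act M g x) = gmod_act (quo_gmod S) g (quo_proj S x).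
Proof. by rewrite [RHS]quo_actE. Qed.

Lemma quo_projK M (S : subrep M) (x : quo_gmod S) : quo_proj S (repr x) = x.
Proof. exact: reprK. Qed.

Lemma quo_proj_eq M (S : subrep M) x y :
  quo_proj S x = quo_proj S y <-> subrep_set S (x - y).
Proof.
split=> [/quo_eqP h|h]; first exact: set_mem h.
by apply/quo_eqP/mem_set.
Qed.

Lemma quo_proj_eq0 M (S : subrep M) x : quo_proj S x = 0 <-> subrep_set S x.
Proof.
have <- : quo_proj S 0 = 0 by exact: raddf0.
by rewrite quo_proj_eq subr0.
Qed.

Fact trivial_subrep_submod M : submod_closed (mem ([set 0] : set M)).
Proof.
split; first exact: mem_set.
move=> a x y /set_mem -> /set_mem ->; apply/mem_set.
by rewrite /= scaler0 addr0.
Qed.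

Fact trivial_subrep_act M g (x : M) : [set 0] x -> [set 0] (gmod_act M g x).
Proof. by move=> ->; rewrite /= raddf0. Qed.

Definition trivial_subrep M : subrep M :=
  SubRep (@trivial_subrep_submod M) (@trivial_subrep_act M).

Section Image.
Variables (M N : gmod R G) (h : ghom M N).

Fact image_subrep_submod : submod_closed (mem (range h)).
Proof.
split; first by apply/mem_set; exists 0; rewrite ?raddf0.
move=> a _ _ /set_mem[x _ <-] /set_mem[y _ <-]; apply/mem_set.
by exists (a *: x + y); rewrite ?linearP.
Qed.

Fact image_subrep_act g y : range h y -> range h (gmod_act N g y).
Proof. by case=> x _ <-; exists (gmod_act M g x); rewrite ?ghom_act. Qed.

Definition image_subrep : subrep N :=
  SubRep image_subrep_submod image_subrep_act.

Fact corestr_subproof x : h x \in subrep_pred image_subrep.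
Proof. by apply/mem_set; exists x. Qed.

Definition corestr_fun x : sub_gmod image_subrep := SubRepElt (corestr_subproof x).

Fact corestr_linear : linear corestr_fun.
Proof. by move=> a x y; apply: val_inj; rewrite /= linearP. Qed.

Fact corestr_act g x :
  corestr_fun (gmod_act M g x) = gmod_act (sub_gmod image_subrep) g (corestr_fun x).
Proof. by apply: val_inj; rewrite /= ghom_act. Qed.

Definition corestr : ghom M (sub_gmod image_subrep) :=
  GHom corestr_linear corestr_act.

Lemma corestr_bij : injective h -> bijective corestr.
Proof.
move=> hinj; have ex_k (y : sub_gmod image_subrep) : exists x, corestr x = y.
  case: y => y hy; have [x _ hx] := set_mem hy.
  by exists x; apply: val_inj.
have [k hk] := choice ex_k; exists k => // x; apply: hinj.
by have /(congr1 val) := hk (corestr x).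
Qed.

End Image.

(** Transport of [f] and [g] along [psi] gives an exact sequence on the subquotient itself, and the
    inverse of [psi] is the required equivalence of extensions. *)
Lemma realises_of_subquo M (A B U : gmod R G) (f : ghom B U) (g : ghom U A)
    (fg : short_exact f g) (U0 U1 : subrep M) (psi : ghom U (subquo U0 U1)) :
  U0 `<=` U1 -> bijective psi -> mod_realises M (Extension fg).
Proof.
move=> U01 psi_bij; have [phi psiK phiK] := inv_ghom psi_bij.
have [f' f'E] := comp_ghom psi f; have [g' g'E] := comp_ghom g phi.
have [finj fgex gsurj] := fg.
have fg' : short_exact f' g'.
  split.
  - by move=> x y; rewrite !f'E /= => /(can_inj psiK)/finj.
  - apply/seteqP; split=> x.
      case=> y _ <-; rewrite /= g'E f'E /= psiK.
      by have : range f (f y) by []; rewrite fgex.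
    rewrite /= g'E /= => gx; have : range f (phi x) by rewrite fgex.
    by case=> y _ hy; exists y; rewrite // f'E /= hy phiK.
  apply/seteqP; split=> // a _; have : range g a by rewrite gsurj.
  by case=> u _ <-; exists (psi u); rewrite // g'E /= psiK.
exists U0, U1; split=> //; exists f', g', fg', phi; split=> /=.
- by exists psi.
- by move=> b; rewrite f'E /= psiK.
by move=> u; rewrite g'E.
Qed.

(** The image of [h] is presented as a subquotient with [U0 = 0]. *)
Lemma embedding_realises M (A B U : gmod R G) (f : ghom B U) (g : ghom U A)
    (fg : short_exact f g) (h : ghom U M) :
  injective h -> mod_realises M (Extension fg).
Proof.
move=> hinj; pose Z := trivial_subrep M; pose S := image_subrep h.
have qlin : linear (@quo_proj R G _ (subrep_res Z S)) by exact: quo_proj_linear.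
pose q := GHom qlin (quo_proj_act (subrep_res Z S)).
have [psi psiE] := comp_ghom q (corestr h).
apply: (realises_of_subquo fg (U0 := Z) (U1 := S) (psi := psi)).
  by move=> x ->; exists 0; rewrite ?raddf0.
have [k hk kh] := corestr_bij hinj.
have {}psiE u : psi u = quo_proj (subrep_res Z S) (corestr h u) by exact: psiE.
(* Modulo 0 a class has only one representative, so [repr] followed by [k] inverts [psi]. *)
exists (fun x => k (repr x)) => x; last by rewrite psiE kh quo_projK.
apply: hinj; have := psiE x; rewrite -[LHS]quo_projK => /quo_proj_eq /eqP.
rewrite subr_eq0 => /eqP hx.
by have /(congr1 val) := kh (repr (psi x)); rewrite [LHS]/= => ->.
Qed.

(* The kernel of [h] meets the image of [f] trivially, hence maps injectively to
   [A]; were it nonzero, it would be the image of a section of [g]. *)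
Lemma nonsplit_injective (A B U N : gmod R G) (f : ghom B U) (g : ghom U A)
    (fg : short_exact f g) (h : ghom U N) (b : B) :
    girreducible A -> girreducible B -> ~ ext_split (Extension fg) ->
  h (f b) != 0 -> injective h.
Proof.
move=> [_ irrA] [_ irrB] nsplit hb; have [finj fgex gsurj] := fg.
(* The kernel of [h] after [f] misses [b], so it is 0 by irreducibility of [B]. *)
have kerf c : h (f c) = 0 -> c = 0.
  pose D : set B := [set c | h (f c) = 0].
  have Dsub : submod_closed (mem D).
    split; first by apply/mem_set; rewrite /D /= !raddf0.
    move=> a x y /set_mem hx /set_mem hy; apply/mem_set.
    by rewrite /D /= !linearP /= hx hy scaler0 addr0.
  have Dact k x : D x -> D (gmod_act B k x).
    by rewrite /D /= !ghom_act => ->; rewrite raddf0.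
  have [/= DE|/= DE] := irrB (SubRep Dsub Dact).
    by move=> hc; have : D c by []; rewrite DE.
  by have : D b by [rewrite DE]; rewrite /D /= => hb0; rewrite hb0 eqxx in hb.
have kerg u : h u = 0 -> g u = 0 -> u = 0.
  move=> hu gu; have : range f u by rewrite fgex.
  by case=> c _ cu; rewrite -cu (kerf c) ?raddf0 // cu.
pose D : set A := [set a | exists2 u, h u = 0 & g u = a].
have Dsub : submod_closed (mem D).
  split; first by apply/mem_set; exists 0; rewrite raddf0.
  move=> a _ _ /set_mem[x hx <-] /set_mem[y hy <-]; apply/mem_set.
  by exists (a *: x + y); rewrite linearP //= hx hy scaler0 addr0.
have Dact k x : D x -> D (gmod_act A k x).
  by case=> u hu <-; exists (gmod_act U k u); rewrite ghom_act // hu raddf0.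
have [/= DE|/= DE] := irrA (SubRep Dsub Dact).
  move=> x y hxy; apply/eqP; rewrite -subr_eq0; apply/eqP.
  have hk : h (x - y) = 0 by rewrite raddfB /= hxy subrr.
  by apply: kerg => //; have : D (g (x - y)) by [exists (x - y)]; rewrite DE.
have ex_s a : exists u, h u = 0 /\ g u = a.
  by have : D a by [rewrite DE]; case=> u; exists u.
have [s hs] := choice ex_s.
have s_uniq u a : h u = 0 -> g u = a -> s a = u.
  move=> hu gu; apply/eqP; rewrite -subr_eq0; apply/eqP; have [hsa gsa] := hs a.
  by apply: kerg; rewrite raddfB /= ?hsa ?gsa ?hu ?gu subrr.
have slin : linear s.
  move=> a x y; have [hx gx] := hs x; have [hy gy] := hs y.
  by apply: s_uniq; rewrite linearP /= ?hx ?hy ?gx ?gy // scaler0 addr0.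
have sact k x : s (gmod_act A k x) = gmod_act U k (s x).
  by have [hx gx] := hs x; apply: s_uniq; rewrite ghom_act ?hx ?gx // raddf0.
by case: nsplit; exists (GHom slin sact) => a; case: (hs a).
Qed.

End Homs.

(** * Multiplication by pi as a map between reductions *)

Section Reductions.
Variables (K : cdvFieldType) (G : groupType) (V : vectType K).
Variable rho : gaction G V.
Implicit Types L : stable_lattice rho.

Lemma red_mapP L (a : integers K) (x y : lat_gmod L) :
  red_map (a *: x + y) = \pi_(residue K) a *: red_map x + red_map y.
Proof.
rewrite /red_map quo_proj_linear; congr (_ + _).
exact: esym (@toF_scaleE _ _ _ (@quo_pi_lat_killed _ _ _ _ L) a (red_map x)).
Qed.

Lemma red_map0 L : red_map (0 : lat_gmod L) = 0.
Proof. exact: (raddf0 (\pi_(quo_type (pi_lat L)))). Qed.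

Lemma red_map_act L g (x : lat_gmod L) :
  red_map (gmod_act (lat_gmod L) g x) = gmod_act (reduction L) g (red_map x).
Proof. exact: quo_proj_act. Qed.

Lemma red_map_surj L (y : reduction L) : exists x : lat_gmod L, red_map x = y.
Proof. by exists (repr (y : quo_gmod (pi_lat L))); apply: quo_projK. Qed.

Section Lifts.
Variables (L : stable_lattice rho) (U : gmod (residue K) G).
Variables (U0 U1 : subrep (reduction L)) (phi : ghom (subquo U0 U1) U).
Hypothesis phi_bij : bijective phi.

(** Graph of the projection onto [U] from the preimage of [U1] in [L]; a relation spares the
    construction of that preimage as a module. *)
Definition lifts (u : U) (x : lat_gmod L) :=
  exists y : sub_gmod U1,
    val y = red_map x /\ phi (quo_proj (subrep_res U0 U1) y) = u.

Lemma lifts_surj u : exists x, lifts u x.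
Proof.
have [phi' phiK phi'K] := phi_bij; pose y := repr (phi' u).
have [x hx] := red_map_surj (val y); exists x, y; split=> //.
by rewrite quo_projK phi'K.
Qed.

Lemma liftsP a u x u' x' : lifts u x -> lifts u' x' ->
  lifts (\pi_(residue K) a *: u + u') (a *: x + x').
Proof.
move=> [y [yx <-]] [y' [yx' <-]]; exists (\pi_(residue K) a *: y + y').
by split; [rewrite red_mapP -yx -yx' | rewrite quo_proj_linear linearP].
Qed.

Lemma lifts_act g u x : lifts u x ->
  lifts (gmod_act U g u) (gmod_act (lat_gmod L) g x).
Proof.
move=> [y [yx <-]]; exists (gmod_act (sub_gmod U1) g y).
by split; [rewrite red_map_act -yx | rewrite quo_proj_act ghom_act].
Qed.

Lemma lifts_eq0 u x : lifts u x -> u = 0 <-> subrep_set U0 (red_map x).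
Proof.
move=> [y [yx <-]]; rewrite -yx; split=> [h|h].
  have /quo_proj_eq0 // : quo_proj (subrep_res U0 U1) y = 0.
  by apply: (bij_inj phi_bij); rewrite h raddf0.
have /quo_proj_eq0-> : subrep_set (subrep_res U0 U1) y by [].
by rewrite raddf0.
Qed.

(** The submodule [A] of the overview, seen inside [V]. *)
Definition red_preimage : set V :=
  [set x | exists2 y : lat_gmod L, val y = x & subrep_set U0 (red_map y)].

Lemma red_preimage_stable : stable_submod rho red_preimage.
Proof.
split; first split.
- by exists 0 => //; rewrite red_map0; apply: subrep0.
- move=> a _ _ ha [x <- hx] [y <- hy]; exists (Integers ha *: x + y) => //.
  by rewrite red_mapP; apply: subrepP.
move=> g _ [x <- hx]; exists (gmod_act (lat_gmod L) g x) => //.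
by rewrite red_map_act; apply: subrep_act.
Qed.

Lemma red_preimage_unif (x : lat_gmod L) : red_preimage (unif *: (val x : V)).
Proof.
exists (unifO *: x) => //.
have /red_map_eq0-> : lat_set L (unif^-1 *: (val (unifO *: x) : V)).
  rewrite [val _]/= [_ *: _]scalerA mulVf ?unif_neq0 // scale1r.
  by case: x => x hx; apply: set_mem.
exact: subrep0.
Qed.

Variable L' : stable_lattice rho.
Hypothesis L'_sup : red_preimage `<=` L'.

Fact unif_map_subproof (x : lat_gmod L) :
  (unif *: (val x : V) : resO V) \in subrep_pred (lat_subrep L').
Proof. exact/mem_set/L'_sup/red_preimage_unif. Qed.

Definition unif_map x : lat_gmod L' := SubRepElt (unif_map_subproof x).

Lemma unif_mapP a x y : unif_map (a *: x + y) = a *: unif_map x + unif_map y.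
Proof.
apply: val_inj; rewrite /= [LHS]scalerDr; congr (_ + _).
by rewrite [LHS]scalerA [RHS]scalerA mulrC.
Qed.

Lemma unif_map_act g x :
  unif_map (gmod_act (lat_gmod L) g x) = gmod_act (lat_gmod L') g (unif_map x).
Proof. by apply: val_inj; rewrite /= /resO_act linearZ. Qed.

Lemma red_unif_map_eq0 x : subrep_set U0 (red_map x) -> red_map (unif_map x) = 0.
Proof.
move=> hx; apply/red_map_eq0; rewrite [val _]/= scalerA mulVf ?unif_neq0 // scale1r.
by apply: L'_sup; exists x.
Qed.

(** Two lifts of [u] differ by an element of [red_preimage], hence of [L'], and pi times this
    element dies modulo [pi L']. So the class of [pi x] depends only on [u], and any choice of lifts
    is linear and equivariant after reduction. *)
Lemma lifted_ghom :
  exists h : ghom U (reduction L'),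
    forall u x, lifts u x -> h u = red_map (unif_map x).
Proof.
have [s hs] := choice lifts_surj.
have sE u x : lifts u x -> red_map (unif_map (s u)) = red_map (unif_map x).
  move=> ux; have := liftsP (-1) ux (hs u).
  rewrite rmorphN1 scaleN1r addNr => /lifts_eq0 [/(_ erefl)/red_unif_map_eq0 + _].
  rewrite unif_mapP red_mapP rmorphN1 scaleN1r addrC => /eqP.
  by rewrite subr_eq0 => /eqP.
have hlin : linear (fun u => red_map (unif_map (s u))).
  move=> a u u'; rewrite -[a]reprK -red_mapP -unif_mapP; apply: sE.
  by apply: liftsP.
have hact g u : red_map (unif_map (s (gmod_act U g u))) =
    gmod_act (reduction L') g (red_map (unif_map (s u))).
  by rewrite -red_map_act -unif_map_act; apply/sE/lifts_act.
by exists (GHom hlin hact).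
Qed.

End Lifts.
End Reductions.

(** * The maximal lattice realising the extension *)

Theorem theorem4p4 (K : cdvFieldType) (G : groupType) (V : vectType K)
    (rho : gaction G V)
    (rho_irr : girreducible (GMod rho))
    (rho_lat : inhabited (stable_lattice rho))
    (r : nat) (W : 'I_r -> gmod (residue K) G) (m : 'I_r -> nat)
    (m_gt0 : forall i, (0 < m i)%N)
    (W_irr : forall i, girreducible (W i))
    (W_noniso : forall i j, i <> j -> ~ gisom (W i) (W j))
    (rho_ss : is_reduction_ss rho
                (dirsum (fun i : 'I_r => dirsum (fun _ : 'I_(m i) => W i))))
    (i j : 'I_r)
    (U : gmod (residue K) G) (f : ghom (W j) U) (g : ghom U (W i))
    (fg : short_exact f g)
    (alpha_nonsplit : ~ ext_split (Extension fg))
    (alpha_real : rep_realises rho (Extension fg)) :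
  exists Lx : stable_lattice rho,
    [/\ maximal_lattice Lx,
        exists S : subrep (reduction Lx), gisom U (sub_gmod S)
      & lat_realises Lx (Extension fg)].

Proof.
have [L [U0 [U1 [_ [f' [g' [fg' [phi [/= phi_bij _ _]]]]]]]]] := alpha_real.
have [[w w0] _] := W_irr j; have [finj _ _] := fg.
have [x0 fwx0] := lifts_surj phi_bij (f w).
(* Since [f w] is nonzero in [U], its lift [x0] cannot reduce into [U0]. *)
have x0A : ~ red_preimage U0 (val x0 : V).
  case=> y /val_inj-> /(lifts_eq0 phi_bij fwx0); rewrite -[RHS](raddf0 f).
  by move/finj/eqP; rewrite (negPf w0).
pose v : V := unif *: (val x0 : V).
have vE : unif^-1 *: v = val x0 by rewrite scalerA mulVf ?unif_neq0 // scale1r.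
have Av' : ~ red_preimage U0 (unif^-1 *: v) by rewrite vE.
have [Lx maxLx ALx] := exists_maximal_above rho_irr (red_preimage_stable U0)
  (red_preimage_unif U0 x0) Av'.
have [h hE] := lifted_ghom phi_bij ALx.
(* [h (f w)] is the class of [v] modulo [pi Lx], nonzero because [Lx] is normalised at [v]. *)
have hfw : h (f w) != 0.
  rewrite (hE _ _ fwx0); apply/eqP => /red_map_eq0.
  by have [/normalisedE[]] := maxLx.
have hinj := nonsplit_injective (W_irr i) (W_irr j) alpha_nonsplit hfw.
exists Lx; split; first by exists v.
  by exists (image_subrep h), (corestr h); apply: corestr_bij.
exact: embedding_realises hinj.
Qed.
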